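(* Let $\pi_\mu$ be a Jacobian Poisson structure on $\mathbb{R}^4$ determined by a function $\mu$ and two generic polynomial functions $P_1,P_2$, and let $\mathrm{d}^k=[\pi_\mu,\cdot]_{SN}\colon\mathfrak{X}^k(\mathbb{R}^4)\to\mathfrak{X}^{k+1}(\mathbb{R}^4)$ be the coboundary operators of its Poisson cohomology with smooth coefficients. Then, identifying multivector fields with tuples of coefficient functions, for all $g\in C^\infty(\mathbb{R}^4)$, $Y\in\mathfrak{X}^1(\mathbb{R}^4)$, $W\in\mathfrak{X}^2(\mathbb{R}^4)$, $Z\in\mathfrak{X}^3(\mathbb{R}^4)$: $$\mathrm{d}^0(g)=\mu\,\nabla g\,\bar{\times}\,(\nabla P_1\times\nabla P_2),$$ $$\mathrm{d}^1(Y)=K^{-1}\big[\phi(\mathrm{d}^0\times Y)-Y(\mu\,\nabla P_1\times\nabla P_2)\big],$$ $$\mathrm{d}^2(W)=D\Big[-\mathrm{d}^0\,\bar{\times}\,\phi(K(W))+\tfrac1\mu\,\mathrm{d}^0(\mu)\,\bar{\times}\,\phi(K(W))+\nabla(\mu\,\nabla P_1\times\nabla P_2)\cdot\phi(K(W))\Big],$$ $$\mathrm{d}^3(Z)=-\mu\,(\nabla\times D(Z))\cdot\phi(\nabla P_1\times\nabla P_2)-\tfrac1\mu\,D(Z)\cdot\mathrm{d}^0(\mu).$$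
   Context: **Jacobian structure.** On $\mathbb{R}^4$, for a function $\mu$ and two generic polynomials $P_1,P_2$, the bracket is defined by $\{x_i,x_j\}_\mu=\mu\,\dfrac{dx_i\wedge dx_j\wedge dP_1\wedge dP_2}{dx_1\wedge dx_2\wedge dx_3\wedge dx_4}$, and $\pi_\mu=\sum_{i<j}\{x_i,x_j\}_\mu\,\partial_{ij}$ is its bivector field. Hamiltonian vector fields of the coordinates: $X_i^\mu=\sum_{j=1}^4\{x_i,x_j\}_\mu\partial_j$. **Notation.** $\partial_{i\cdots k}=\partial_i\wedge\cdots\wedge\partial_k$, $\mathcal{A}=C^\infty(\mathbb{R}^4)$. **Schouten–Nijenhuis bracket.** With $\zeta_i=\partial_{x_i}$ regarded as odd variables, for a $p$-vector field $P$ and a $q$-vector field $Q$, $[P,Q]_{SN}=\sum_i\partial_{\zeta_i}(P)\,\partial_{x_i}(Q)-(-1)^{(p-1)(q-1)}\partial_{\zeta_i}(Q)\,\partial_{x_i}(P)$, where $\partial_{\zeta_{i_k}}(\zeta_{i_1}\cdots\zeta_{i_p})=(-1)^{p-k}\zeta_{i_1}\cdots\widehat{\zeta_{i_k}}\cdots\zeta_{i_p}$. **Identifications.** Vector fields $\sum f_i\partial_i\leftrightarrow(f_1,f_2,f_3,f_4)^T$. Bivector fields $\sum_{i<j}f_{ij}\partial_{ij}\leftrightarrow(f_{12},f_{13},f_{14},f_{23},f_{24},f_{34})^T$. 3-vector fields $\sum f_{ijk}\partial_{ijk}\leftrightarrow(f_{123},f_{124},f_{134},f_{234})^T$. 4-vector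 fields $f\partial_{1234}\leftrightarrow f$. In each formula the left side is a multivector field and the right side is its tuple of coefficients. **Operators.** - $D(f_1,f_2,f_3,f_4)^T=(f_4,-f_3,f_2,-f_1)^T$ on $\mathcal{A}^4$; in particular $D(Z)=(f_{234},-f_{134},f_{124},-f_{123})^T$ for $Z=\sum f_{ijk}\partial_{ijk}$. - $K(f_{12},f_{13},f_{14},f_{23},f_{24},f_{34})^T=(f_{23},f_{34},-f_{14},f_{12},f_{24},-f_{13})^T$ on $\mathcal{A}^6$. - $\phi(u_1,\dots,u_6)^T=(-u_3,u_4,-u_1,u_2,u_6,u_5)^T$ on $\mathcal{A}^6$. - For $X,Y\in\mathcal{A}^4$ with entries $x_i$, $y_j$: $X\times Y=(x_1y_4-x_4y_1,\;x_1y_2-x_2y_1,\;x_3y_2-x_2y_3,\;x_3y_4-x_4y_3,\;x_3y_1-x_1y_3,\;x_2y_4-x_4y_2)^T\in\mathcal{A}^6$. - For $X\in\mathcal{A}^4$ with entries $x_i$ and $U=(f_{12},f_{13},f_{14},f_{23},f_{24},f_{34})^T\in\mathcal{A}^6$: $$X\,\bar\times\,U=\begin{pmatrix}-x_4f_{14}+x_2f_{23}-x_3f_{34}\\ x_3f_{12}-x_1f_{23}+x_4f_{24}\\ -x_2f_{12}+x_4f_{13}+x_1f_{34}\\ -x_3f_{13}+x_1f_{14}-x_2f_{24}\end{pmatrix}\in\mathcal{A}^4.$$ - $\nabla g=(\partial_1g,\dots,\partial_4g)^T$. For $X\in\mathcal{A}^4$, $\nabla\times X=(\partial_1x_4-\partial_4x_1,\;\partial_1x_2-\partial_2x_1,\;\partial_3x_2-\partial_2x_3,\;\partial_3x_4-\partial_4x_3,\;\partial_3x_1-\partial_1x_3,\;\partial_2x_4-\partial_4x_2)^T$.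 - In $\mathrm{d}^0\times Y$ and $\mathrm{d}^0\,\bar\times\,U$, the symbol $\mathrm{d}^0$ (without argument) denotes the vector of derivations $(X_1^\mu,X_2^\mu,X_3^\mu,X_4^\mu)^T$ acting on the coefficient functions: $\mathrm{d}^0\times Y$ is $\nabla\times Y$ with $\partial_i$ replaced by $X_i^\mu$, and $\mathrm{d}^0\,\bar\times\,U$ is the formula for $X\,\bar\times\,U$ with each $x_i f_{jk}$ replaced by $X_i^\mu(f_{jk})$. $\mathrm{d}^0(\mu)$ is the 4-tuple $(X_1^\mu(\mu),\dots,X_4^\mu(\mu))^T$, and $\frac1\mu\mathrm{d}^0(\mu)$ is understood as $\nabla\mu\,\bar\times\,(\nabla P_1\times\nabla P_2)$. - $Y(\mu\,\nabla P_1\times\nabla P_2)$: the vector field $Y$ acts as a derivation on each entry of the 6-tuple $\mu\,(\nabla P_1\times\nabla P_2)$. - For 6-tuples $A,B$, $\nabla(A)\cdot B$ is the 4-tuple whose $i$-th entry is $\sum_j\partial_i(A_j)B_j$. - In all other places $\cdot$ is the Euclidean dot product of tuples. *)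

(* Defs.v *)
From HB Require Import structures.
From mathcomp Require Import all_boot all_order all_algebra.
From mathcomp Require Import all_classical all_reals all_analysis.
(* Not imported: its notations clash with those of the analysis library. *)
From mathcomp Require mpoly.

Set Implicit Arguments.
Unset Strict Implicit.
Unset Printing Implicit Defensive.
Import Order.TTheory GRing.Theory Num.Theory.
Import numFieldNormedType.Exports.
Local Open Scope ring_scope.

(* Indices 1, ..., 4 and 1, ..., 6 as ordinals. *)
Definition i1 : 'I_4 := @Ordinal 4 0 isT.
Definition i2 : 'I_4 := @Ordinal 4 1 isT.
Definition i3 : 'I_4 := @Ordinal 4 2 isT.
Definition i4 : 'I_4 := @Ordinal 4 3 isT.

Definition j1 : 'I_6 := @Ordinal 6 0 isT.
Definition j2 : 'I_6 := @Ordinal 6 1 isT.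
Definition j3 : 'I_6 := @Ordinal 6 2 isT.
Definition j4 : 'I_6 := @Ordinal 6 3 isT.
Definition j5 : 'I_6 := @Ordinal 6 4 isT.
Definition j6 : 'I_6 := @Ordinal 6 5 isT.

(* Functions form a ring under the pointwise operations; smoothness is a
   separate predicate. *)
Definition fn (R : realType) := 'rV[R]_4 -> R.

Definition partial (R : realType) (i : 'I_4) (f : fn R) : fn R :=
  fun x => 'D_(delta_mx 0 i) f x.

(* All iterated partial derivatives exist and are continuous. *)
Definition smooth (R : realType) (f : fn R) : Prop :=
  forall s : seq 'I_4,
    let h := foldr (@partial R) f s in
    continuous h /\ forall i x, derivable h x (delta_mx 0 i).

Definition poly_fn (R : realType) (P : mpoly.mpoly 4 R) : fn R :=
  fun x => mpoly.meval (x 0) P.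

(* An element of the exterior algebra over the functions, on four odd
   generators z_1, ..., z_4: the value at S is the coefficient of the product
   of the generators z_i, i \in S, taken in increasing order of i.
   With z_i = d/dx_i this is a multivector field, with z_i = dx_i a
   differential form. *)
Definition ext (R : realType) := {set 'I_4} -> fn R.

Definition mono (R : realType) (S : {set 'I_4}) (f : fn R) : ext R :=
  fun T => if T == S then f else 0.

(* Sign of the permutation sorting the concatenation of A and B. *)
Definition shuffle_sign (R : realType) (A B : {set 'I_4}) : fn R :=
  (-1) ^+ #|[set ab : 'I_4 * 'I_4 in finset.setX A B | (ab.2 < ab.1)%N]|.

Definition wedge (R : realType) (P Q : ext R) : ext R :=
  fun S => \sum_(A : {set 'I_4} | A \subset S)
             shuffle_sign A (S :\: A) * (P A * Q (S :\: A)).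

Definition homogeneous (R : realType) (p : nat) (P : ext R) : Prop :=
  forall S : {set 'I_4}, #|S| != p -> P S = 0.

(* Smooth p-vector fields. *)
Definition mvfield (R : realType) (p : nat) (P : ext R) : Prop :=
  homogeneous p P /\ forall S, smooth (P S).

(* Derivative with respect to the odd variable z_i: the sign counts the
   generators standing to the right of z_i. *)
Definition dzeta (R : realType) (i : 'I_4) (P : ext R) : ext R :=
  fun S => if i \in S then 0
           else (-1) ^+ #|[set j in S | (i < j)%N]| * P (i |: S).

Definition dx (R : realType) (i : 'I_4) (P : ext R) : ext R :=
  fun S => partial i (P S).

(* Schouten-Nijenhuis bracket of a p-vector field and a q-vector field.
   (p + 1)(q + 1) has the parity of (p - 1)(q - 1) and avoids the truncated
   subtraction of natural numbers. *)
Definition schouten (R : realType) (p q : nat) (P Q : ext R) : ext R :=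
  \sum_(i < 4) (wedge (dzeta i P) (dx i Q)
                - (fun S => (-1) ^+ (p.+1 * q.+1)
                            * wedge (dzeta i Q) (dx i P) S)).

(* Supports of the coefficients in the order in which they are listed in the
   tuples representing p-vector fields, p = 1, 2, 3. *)
Definition supp1 : 4.-tuple {set 'I_4} :=
  [tuple [set i1]; [set i2]; [set i3]; [set i4]].
Definition supp2 : 6.-tuple {set 'I_4} :=
  [tuple [set i1; i2]; [set i1; i3]; [set i1; i4];
         [set i2; i3]; [set i2; i4]; [set i3; i4]].
Definition supp3 : 4.-tuple {set 'I_4} :=
  [tuple [set i1; i2; i3]; [set i1; i2; i4];
         [set i1; i3; i4]; [set i2; i3; i4]].

Definition coefs (R : realType) (n : nat) (B : n.-tuple {set 'I_4})
    (P : ext R) : 'cV[fn R]_n :=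
  \col_k P (tnth B k).

Definition of_coefs (R : realType) (n : nat) (B : n.-tuple {set 'I_4})
    (u : 'cV[fn R]_n) : ext R :=
  \sum_(k < n) mono (tnth B k) (u k 0).

Definition vec0 (R : realType) (f : fn R) : ext R := mono finset.set0 f.
Definition vec1 (R : realType) : 'cV[fn R]_4 -> ext R := of_coefs supp1.
Definition vec2 (R : realType) : 'cV[fn R]_6 -> ext R := of_coefs supp2.
Definition vec3 (R : realType) : 'cV[fn R]_4 -> ext R := of_coefs supp3.
Definition vec4 (R : realType) (f : fn R) : ext R := mono [set: 'I_4] f.

Definition col4 (R : realType) (a b c d : fn R) : 'cV[fn R]_4 :=
  \col_k tnth [tuple a; b; c; d] k.
Definition col6 (R : realType) (a b c d e f : fn R) : 'cV[fn R]_6 :=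
  \col_k tnth [tuple a; b; c; d; e; f] k.

Definition opD (R : realType) (u : 'cV[fn R]_4) : 'cV[fn R]_4 :=
  col4 (u i4 0) (- u i3 0) (u i2 0) (- u i1 0).

Definition opK (R : realType) (u : 'cV[fn R]_6) : 'cV[fn R]_6 :=
  col6 (u j4 0) (u j6 0) (- u j3 0) (u j1 0) (u j5 0) (- u j2 0).

Definition opKinv (R : realType) (v : 'cV[fn R]_6) : 'cV[fn R]_6 :=
  col6 (v j4 0) (- v j6 0) (- v j3 0) (v j1 0) (v j5 0) (v j2 0).

Lemma opKK (R : realType) : cancel (@opK R) (@opKinv R).
Proof.
move=> u; apply/matrixP=> k l; rewrite (ord1 l) /opKinv /opK /col6 !mxE.
by case: k => [[|[|[|[|[|[|k]]]]]] Hk] //=; rewrite (tnth_nth 0) /= ?opprK;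
  congr (u _ _); apply/val_inj.
Qed.

Lemma opKinvK (R : realType) : cancel (@opKinv R) (@opK R).
Proof.
move=> u; apply/matrixP=> k l; rewrite (ord1 l) /opKinv /opK /col6 !mxE.
by case: k => [[|[|[|[|[|[|k]]]]]] Hk] //=; rewrite (tnth_nth 0) /= ?opprK;
  congr (u _ _); apply/val_inj.
Qed.

Definition phi (R : realType) (u : 'cV[fn R]_6) : 'cV[fn R]_6 :=
  col6 (- u j3 0) (u j4 0) (- u j1 0) (u j2 0) (u j6 0) (u j5 0).

(* The two cross products with the entries of the first factor acting on the
   entries of the second one by arbitrary operators: [a i f] stands for the
   product of the i-th entry with f, or for a derivation applied to f. *)
Definition cross_op (R : realType) (a : 'I_4 -> fn R -> fn R)
    (y : 'cV[fn R]_4) : 'cV[fn R]_6 :=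
  col6 (a i1 (y i4 0) - a i4 (y i1 0))
       (a i1 (y i2 0) - a i2 (y i1 0))
       (a i3 (y i2 0) - a i2 (y i3 0))
       (a i3 (y i4 0) - a i4 (y i3 0))
       (a i3 (y i1 0) - a i1 (y i3 0))
       (a i2 (y i4 0) - a i4 (y i2 0)).

Definition barcross_op (R : realType) (a : 'I_4 -> fn R -> fn R)
    (u : 'cV[fn R]_6) : 'cV[fn R]_4 :=
  let f12 := u j1 0 in let f13 := u j2 0 in let f14 := u j3 0 in
  let f23 := u j4 0 in let f24 := u j5 0 in let f34 := u j6 0 in
  col4 (- a i4 f14 + a i2 f23 - a i3 f34)
       (a i3 f12 - a i1 f23 + a i4 f24)
       (- a i2 f12 + a i4 f13 + a i1 f34)
       (- a i3 f13 + a i1 f14 - a i2 f24).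

Definition cross (R : realType) (x y : 'cV[fn R]_4) : 'cV[fn R]_6 :=
  cross_op (fun i f => x i 0 * f) y.

Definition barcross (R : realType) (x : 'cV[fn R]_4) (u : 'cV[fn R]_6) :
    'cV[fn R]_4 :=
  barcross_op (fun i f => x i 0 * f) u.

Definition grad (R : realType) (g : fn R) : 'cV[fn R]_4 :=
  \col_i partial i g.

Definition curl (R : realType) (x : 'cV[fn R]_4) : 'cV[fn R]_6 :=
  cross_op (@partial R) x.

Definition dot (R : realType) (n : nat) (x y : 'cV[fn R]_n) : fn R :=
  \sum_(i < n) x i 0 * y i 0.

Definition grad_dot (R : realType) (A B : 'cV[fn R]_6) : 'cV[fn R]_4 :=
  \col_i \sum_(j < 6) partial i (A j 0) * B j 0.

(* The vector field Y acting on each entry of A. *)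
Definition vf_act (R : realType) (Y : 'cV[fn R]_4) (A : 'cV[fn R]_6) :
    'cV[fn R]_6 :=
  \col_k \sum_(i < 4) Y i 0 * partial i (A k 0).

Definition dform (R : realType) (f : fn R) : ext R :=
  \sum_(i < 4) mono [set i] (partial i f).

(* A 4-form divided by dx_1 /\ dx_2 /\ dx_3 /\ dx_4 is its coefficient at the
   full set. *)
Definition jbracket (R : realType) (mu P1 P2 : fn R) (i j : 'I_4) : fn R :=
  mu * wedge (wedge (wedge (mono [set i] 1) (mono [set j] 1)) (dform P1))
             (dform P2) [set: 'I_4].

Definition jpi (R : realType) (mu P1 P2 : fn R) : ext R :=
  \sum_(i < 4) \sum_(j < 4 | (i < j)%N)
    mono [set i; j] (jbracket mu P1 P2 i j).

(* The Hamiltonian vector field X_i^mu acting on functions. *)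
Definition ham (R : realType) (mu P1 P2 : fn R) (i : 'I_4) (f : fn R) : fn R :=
  \sum_(j < 4) jbracket mu P1 P2 i j * partial j f.

(* The k-th coboundary operator of Poisson cohomology. *)
Definition cobd (R : realType) (mu P1 P2 : fn R) (k : nat) (Q : ext R) :
    ext R :=
  schouten 2 k (jpi mu P1 P2) Q.

(* (1/mu) d^0(mu), in the form that makes sense at the zeros of mu. *)
Definition dlog (R : realType) (mu P1 P2 : fn R) : 'cV[fn R]_4 :=
  barcross (grad mu) (cross (grad P1) (grad P2)).

(* Main.v *)
Require Import Defs.
From HB Require Import structures.
From mathcomp Require Import all_boot all_order all_algebra.
From mathcomp Require Import all_classical all_reals all_analysis.
From mathcomp Require mpoly.
From mathcomp Require Import ring.
Import Order.TTheory GRing.Theory Num.Theory.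
Import numFieldNormedType.Exports.
Local Open Scope ring_scope.
Set Implicit Arguments.
Unset Strict Implicit.
Unset Printing Implicit Defensive.

(** The six coefficients of [dP1 /\ dP2] are, up to order and sign, the entries
    of [U = cross (grad P1) (grad P2)], and contracting this 2-form with the
    volume form gives the Jacobian structure: its bivector is [K^-1 (mu U)]
    ([jpiE]), and its Hamiltonian vector fields satisfy
    [X_i f = mu (grad f barcross U)_i] ([hamE]).  So the theorem is about the
    Schouten bracket with a bivector field [K^-1 (mu U)], where [P1] and [P2] enter
    through the fact that [dP1 /\ dP2] is closed, i.e. that
    [barcross_op partial U = 0] ([cross_grad_closed]).

    In degrees 0 and 1 the formulas are formal: the bracket with a bivector [pi]
    sends [g] to the vector with entries [X_i g], and [Y] to the bivector with
    entries [X_i Y_j - X_j Y_i - Y (pi_ij)], which [K], [phi] and the cross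
    products merely rearrange ([schouten0_jacobian], [schouten1_jacobian]).
    In degrees 2 and 3 the bracket differentiates [mu U] in combinations that
    differ from those on the right-hand sides; by the Leibniz rule the discrepancy
    splits into derivatives of [mu], which make up the terms in [d^0 mu / mu], and
    derivatives of [U], which cancel because [U] is closed
    ([schouten2_jacobian], [schouten3_jacobian]).

    These identities are polynomial in the functions involved and their partial
    derivatives.  To reach them, the exterior algebra is made computational:
    subsets of ['I_4] are written as four booleans, so that a multivector field
    becomes a table of sixteen functions on which the wedge product, the odd
    derivatives and the Schouten bracket evaluate ([tab_schoutenE]).  Each degree
    is then checked entry by entry with [ring]. *)

(** * Partial derivatives *)

Section Partials.
Variable R : realType.
Implicit Types f g : fn R.

(** Weaker than [smooth], so that one application of the Leibniz rule shows that
    it passes to products. *)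
Definition has_partials f : Prop := forall i x, derivable f x (delta_mx 0 i).

Lemma smooth_partials f : smooth f -> has_partials f.
Proof. by move=> /(_ [::]) []. Qed.

Lemma has_partialsN f : has_partials f -> has_partials (- f).
Proof. by move=> df i x; exact: derivableN. Qed.

Lemma has_partialsD f g :
  has_partials f -> has_partials g -> has_partials (f + g).
Proof. by move=> df dg i x; exact: derivableD. Qed.

Lemma has_partialsM f g :
  has_partials f -> has_partials g -> has_partials (f * g).
Proof. by move=> df dg i x; exact: derivableM. Qed.

Lemma has_partials_cst (c : R) : has_partials (cst c : fn R).
Proof. by move=> i x; exact: derivable_cst. Qed.

Lemma partial_cst i (c : R) : partial i (cst c : fn R) = 0.
Proof. by apply/funext => x; rewrite /partial derive_cst. Qed.

Lemma partial0 i : partial i (0 : fn R) = 0.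
Proof. exact: (partial_cst i 0). Qed.

Lemma partialN i f : has_partials f -> partial i (- f) = - partial i f.
Proof. by move=> df; apply/funext => x; rewrite /partial deriveN. Qed.

Lemma partialD i f g : has_partials f -> has_partials g ->
  partial i (f + g) = partial i f + partial i g.
Proof. by move=> df dg; apply/funext => x; rewrite /partial deriveD. Qed.

Lemma partialM i f g : has_partials f -> has_partials g ->
  partial i (f * g) = partial i f * g + f * partial i g.
Proof.
move=> df dg; apply/funext => x; rewrite /partial deriveM //.
by rewrite addrC [g x *: _]mulrC.
Qed.

End Partials.

(** * Polynomial functions *)

Section PolynomialPartials.
(* Some notations of [mpoly] clash with those already in use. *)
Import -(notations) mpoly.
Variable R : realType.
Implicit Types p q : mpoly 4 R.

Lemma poly_fnD p q : poly_fn (p + q) = poly_fn p + poly_fn q.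
Proof. by apply/funext => x; exact: mevalD. Qed.

Lemma poly_fnM p q : poly_fn (p * q) = poly_fn p * poly_fn q.
Proof. by apply/funext => x; exact: mevalM. Qed.

Lemma poly_fnC (c : R) : poly_fn (mpolyC 4 c) = cst c.
Proof. by apply/funext => x; exact: mevalC. Qed.

Lemma poly_fnX j : poly_fn (mpolyX R (mnm1 j)) = (fun x => x 0 j).
Proof. by apply/funext => x; exact: mevalXU. Qed.

Definition formal_partials p : Prop := has_partials (poly_fn p) /\
  forall i, partial i (poly_fn p) = poly_fn (mderiv i p).

Lemma formal_partialsC (c : R) : formal_partials (mpolyC 4 c).
Proof.
rewrite /formal_partials poly_fnC; split=> [|i]; first exact: has_partials_cst.
by rewrite partial_cst mderivC poly_fnC.
Qed.

(** The derivative of a coordinate is read off the derivative of the identity of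
    ['rV[R]_4], which is computed entrywise. *)
Lemma formal_partialsX j : formal_partials (mpolyX R (mnm1 j)).
Proof.
rewrite /formal_partials poly_fnX.
have dj i x : derivable (fun x : 'rV[R]_4 => x 0 j : R) x (delta_mx 0 i).
  by apply: diff_derivable; exact: differentiable_coord.
split=> [i x //|i]; apply/funext => x; rewrite mderivX mnm1E /partial.
have := @derive_id _ _ x (delta_mx 0 i); rewrite derive_mx //.
move=> /(congr1 (fun M : 'rV[R]_4 => M 0 j)); rewrite !mxE eqxx /= => ->.
case: eqVneq => [->|ne].
  have -> : mnm_sub (mnm1 i) (mnm1 i) = mnm0.
    by apply/mnmP => k; rewrite mnmBE subnn mnm0E.
  by rewrite mpolyX0 scale1r -(mpolyC1 4 R) poly_fnC.
by rewrite /= mulr0n scale0r -(mpolyC0 4 R) poly_fnC.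
Qed.

Lemma formal_partialsD p q :
  formal_partials p -> formal_partials q -> formal_partials (p + q).
Proof.
move=> [dp ep] [dq eq]; rewrite /formal_partials poly_fnD; split=> [|i].
  exact: has_partialsD.
by rewrite partialD // ep eq mderivD poly_fnD.
Qed.

Lemma formal_partialsM p q :
  formal_partials p -> formal_partials q -> formal_partials (p * q).
Proof.
move=> [dp ep] [dq eq]; rewrite /formal_partials poly_fnM; split=> [|i].
  exact: has_partialsM.
by rewrite partialM // ep eq mderivM poly_fnD !poly_fnM.
Qed.

(** The polynomials with this property contain the constants and the variables
    and are closed under sums and products. *)
Lemma poly_fn_partials p : formal_partials p.
Proof.
elim/mpolyind: p => [|c m p _ _ IHp].
  by rewrite -(mpolyC0 4 R); exact: formal_partialsC.
apply: formal_partialsD => //; rewrite -mul_mpolyC.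
apply: formal_partialsM; first exact: formal_partialsC.
rewrite (mpolyXE R (perm.perm_one _)).
apply: (big_ind _ _ formal_partialsM) => [|i _]; first exact: formal_partialsC 1.
elim: (m _) => [|k IHk]; first exact: formal_partialsC 1.
by rewrite exprS; apply: formal_partialsM => //; exact: formal_partialsX.
Qed.

Lemma has_partials_grad_poly i p : has_partials (partial i (poly_fn p)).
Proof. by rewrite (poly_fn_partials p).2; exact: (poly_fn_partials _).1. Qed.

(** For polynomials the symmetry of second derivatives is a formal identity. *)
Lemma partial_poly_comm i j p :
  partial i (partial j (poly_fn p)) = partial j (partial i (poly_fn p)).
Proof.
have e q k : partial k (poly_fn q) = poly_fn (mderiv k q).
  by rewrite (poly_fn_partials q).2.
by rewrite !e mderiv_comm.
Qed.

End PolynomialPartials.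

(** * Subsets of the index set as four booleans *)

Section Subsets.

Definition bset (a b c d : bool) : {set 'I_4} :=
  [set i : 'I_4 | nth false [:: a; b; c; d] i].

Lemma big_I4 (V : nmodType) (F : 'I_4 -> V) :
  \sum_(i < 4) F i = F i1 + F i2 + F i3 + F i4.
Proof.
rewrite !big_ord_recl big_ord0 addr0 !addrA.
by congr (_ + F _ + F _ + F _); [congr F|..]; apply/val_inj.
Qed.

Lemma big_I6 (V : nmodType) (F : 'I_6 -> V) :
  \sum_(i < 6) F i = F j1 + F j2 + F j3 + F j4 + F j5 + F j6.
Proof.
rewrite !big_ord_recl big_ord0 addr0 !addrA.
by congr (_ + F _ + F _ + F _ + F _ + F _); [congr F|..]; apply/val_inj.
Qed.

Lemma all_I4 (P : 'I_4 -> Prop) : P i1 -> P i2 -> P i3 -> P i4 -> forall i, P i.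
Proof.
move=> p1 p2 p3 p4 [[|[|[|[|k]]]] Hk] //.
- by have -> : Ordinal Hk = i1 by apply/val_inj.
- by have -> : Ordinal Hk = i2 by apply/val_inj.
- by have -> : Ordinal Hk = i3 by apply/val_inj.
- by have -> : Ordinal Hk = i4 by apply/val_inj.
Qed.

Lemma all_I6 (P : 'I_6 -> Prop) :
  P j1 -> P j2 -> P j3 -> P j4 -> P j5 -> P j6 -> forall i, P i.
Proof.
move=> p1 p2 p3 p4 p5 p6 [[|[|[|[|[|[|k]]]]]] Hk] //.
- by have -> : Ordinal Hk = j1 by apply/val_inj.
- by have -> : Ordinal Hk = j2 by apply/val_inj.
- by have -> : Ordinal Hk = j3 by apply/val_inj.
- by have -> : Ordinal Hk = j4 by apply/val_inj.
- by have -> : Ordinal Hk = j5 by apply/val_inj.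
- by have -> : Ordinal Hk = j6 by apply/val_inj.
Qed.

Lemma bset_mem (S : {set 'I_4}) :
  S = bset (i1 \in S) (i2 \in S) (i3 \in S) (i4 \in S).
Proof. by apply/setP; apply: all_I4; rewrite inE. Qed.

Lemma eq_bset a b c d a' b' c' d' :
  (bset a b c d == bset a' b' c' d') = [&& a == a', b == b', c == c' & d == d'].
Proof.
apply/eqP/and4P => [/setP e|[/eqP-> /eqP-> /eqP-> /eqP->] //].
by move: (e i1) (e i2) (e i3) (e i4); rewrite !inE /= => -> -> -> ->.
Qed.

Lemma sub_bset a b c d a' b' c' d' :
  (bset a b c d \subset bset a' b' c' d') =
  [&& a ==> a', b ==> b', c ==> c' & d ==> d'].
Proof.
apply/fintype.subsetP/and4P
  => [sub|[/implyP h1 /implyP h2 /implyP h3 /implyP h4]].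
  by move: (sub i1) (sub i2) (sub i3) (sub i4); rewrite !inE /=;
    split; apply/implyP.
by apply: all_I4; rewrite !inE.
Qed.

Lemma bsetD a b c d a' b' c' d' :
  bset a b c d :\: bset a' b' c' d' =
  bset (a && ~~ a') (b && ~~ b') (c && ~~ c') (d && ~~ d').
Proof. by apply/setP; apply: all_I4; rewrite !inE /= andbC. Qed.

Lemma bsetU a b c d a' b' c' d' :
  bset a b c d :|: bset a' b' c' d' =
  bset (a || a') (b || b') (c || c') (d || d').
Proof. by apply/setP; apply: all_I4; rewrite !inE. Qed.

Lemma bset0 : finset.set0 = bset false false false false.
Proof. by apply/setP; apply: all_I4; rewrite !inE. Qed.

Lemma bset1 (i : 'I_4) :
  [set i] = bset (i == i1) (i == i2) (i == i3) (i == i4).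
Proof. by apply/setP; apply: all_I4; rewrite !inE /= eq_sym. Qed.

Lemma bsetT : [set: 'I_4] = bset true true true true.
Proof. by apply/setP; apply: all_I4; rewrite !inE. Qed.

Lemma card_bset a b c d : #|bset a b c d| = (a + b + c + d)%N.
Proof.
by rewrite -sum1_card big_mkcond big_I4 !inE; case: a b c d => [] [] [] [].
Qed.

Lemma sum_bset (V : nmodType) (F : {set 'I_4} -> V) :
  \sum_(S : {set 'I_4}) F S =
  \sum_(a : bool) \sum_(b : bool) \sum_(c : bool) \sum_(d : bool)
    F (bset a b c d).
Proof.
under [RHS]eq_bigr => a _ do under eq_bigr => b _ do rewrite pair_bigA.
under [RHS]eq_bigr => a _ do rewrite pair_bigA.
rewrite pair_bigA /= (reindex (fun t : bool * (bool * (bool * bool)) =>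
  bset t.1 t.2.1 t.2.2.1 t.2.2.2)) //=.
exists (fun S : {set 'I_4} => (i1 \in S, (i2 \in S, (i3 \in S, i4 \in S)))).
  by move=> [a [b [c d]]] _; rewrite !inE.
by move=> S _; rewrite -bset_mem.
Qed.

Lemma inversions_bset a b c d a' b' c' d' :
  #|[set ij : 'I_4 * 'I_4 in
       finset.setX (bset a b c d) (bset a' b' c' d') | (ij.2 < ij.1)%N]| =
  (b * a' + c * (a' + b') + d * (a' + b' + c'))%N.
Proof.
set A := [set _ in _ | _].
transitivity (\sum_(i < 4) \sum_(j < 4) ((i, j) \in A : nat))%N.
  rewrite pair_bigA -sum1_card big_mkcond.
  by apply: eq_bigr => -[i j] _; case: ifP.
rewrite !big_I4 {}/A !inE /=.
by case: a b c d a' b' c' d' => [] [] [] [] [] [] [] [].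
Qed.

End Subsets.

(** * The exterior algebra on tables of coefficients *)

Section Tables.
Variable R : realType.

Definition table := bool -> bool -> bool -> bool -> fn R.

Implicit Types (P Q : ext R) (p q : table) (f : fn R).

Definition tab P : table := fun a b c d => P (bset a b c d).

Lemma tableP p q : (forall a b c d, p a b c d = q a b c d) -> p = q.
Proof. by move=> e; do 4!(apply/funext => ?). Qed.

Lemma tab_inj P Q : tab P = tab Q -> P = Q.
Proof.
move=> e; apply/funext => S; rewrite (bset_mem S).
exact: (congr1 (fun t : table => t _ _ _ _) e).
Qed.

(** Signs are kept as booleans so that they reduce by computation. *)
Definition flip (s : bool) f : fn R := if s then - f else f.

Lemma signr_flip n f : (-1) ^+ n * f = flip (odd n) f.
Proof. by rewrite -signr_odd /flip; case: (odd n); rewrite ?mulN1r ?mul1r. Qed.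

(** The sum over [a1 <= a]: nesting four of these enumerates the subsets of a
    subset, with no vanishing terms left to discard. *)
Definition sum_le (a : bool) (F : bool -> fn R) : fn R :=
  if a then F true + F false else F false.

Lemma sum_leE a (F G : bool -> fn R) :
  (forall a1, F a1 = if a1 ==> a then G a1 else 0) ->
  \sum_(a1 : bool) F a1 = sum_le a G.
Proof.
by move=> FG; rewrite big_bool !FG /sum_le; case: a {FG} => //=; rewrite add0r.
Qed.

(** The sign is the parity of the number of pairs [j < i] with [i] in the first
    set and [j] in the second, as counted by [inversions_bset]. *)
Definition tab_wedge p q : table := fun a b c d =>
  sum_le a (fun a1 => sum_le b (fun b1 => sum_le c (fun c1 => sum_le d (fun d1 =>
    let a2 := a && ~~ a1 in let b2 := b && ~~ b1 in
    let c2 := c && ~~ c1 in let d2 := d && ~~ d1 in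
    flip ((b1 && a2) (+) (c1 && (a2 (+) b2)) (+) (d1 && (a2 (+) b2 (+) c2)))
      (p a1 b1 c1 d1 * q a2 b2 c2 d2))))).

Lemma tab_wedgeE P Q : tab (wedge P Q) = tab_wedge (tab P) (tab Q).
Proof.
apply: tableP => a b c d; rewrite /tab /wedge big_mkcond sum_bset /tab_wedge.
have sub0 a1 b1 c1 d1 x :
    [&& a1 ==> a, b1 ==> b, c1 ==> c & d1 ==> d] = false ->
    (if bset a1 b1 c1 d1 \subset bset a b c d then x else 0) = 0 :> fn R.
  by move=> e; rewrite sub_bset e.
apply: sum_leE => a1; case: ifP => la; last first.
  by do 3![rewrite big1 // => ? _]; rewrite sub0 ?la.
apply: sum_leE => b1; case: ifP => lb; last first.
  by do 2![rewrite big1 // => ? _]; rewrite sub0 ?la ?lb.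
apply: sum_leE => c1; case: ifP => lc; last first.
  by rewrite big1 // => ? _; rewrite sub0 ?la ?lb ?lc.
apply: sum_leE => d1; rewrite sub_bset la lb lc /=; case: ifP => // _.
rewrite bsetD /shuffle_sign inversions_bset signr_flip !oddD !oddM !oddD.
by rewrite !oddb.
Qed.

Definition tab_dzeta (i : 'I_4) p : table := fun a b c d =>
  match val i with
  | 0%N => if a then 0 else flip (b (+) c (+) d) (p true b c d)
  | 1%N => if b then 0 else flip (c (+) d) (p a true c d)
  | 2%N => if c then 0 else flip d (p a b true d)
  | _ => if d then 0 else p a b c true
  end.

Lemma tab_dzetaE i P : tab (dzeta i P) = tab_dzeta i (tab P).
Proof.
apply: tableP => a b c d.
rewrite /tab /dzeta bset1 bsetU signr_flip -sum1_card big_mkcond /= big_I4.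
rewrite !inE /tab_dzeta.
by move: i; apply: all_I4 => /=; case: a b c d => [] [] [] [].
Qed.

Definition tab_dx i p : table := fun a b c d => partial i (p a b c d).

Lemma tab_dxE i P : tab (dx i P) = tab_dx i (tab P).
Proof. by []. Qed.

Definition tab_summand (k : nat) i p q : table := fun a b c d =>
  tab_wedge (tab_dzeta i p) (tab_dx i q) a b c d
  - flip (~~ odd k) (tab_wedge (tab_dzeta i q) (tab_dx i p) a b c d).

(** The first argument is meant to have degree 2, whence the sign
    [(-1) ^ (3 (k + 1))] in [tab_summand]. *)
Definition tab_schouten (k : nat) p q : table := fun a b c d =>
  tab_summand k i1 p q a b c d + tab_summand k i2 p q a b c d
  + tab_summand k i3 p q a b c d + tab_summand k i4 p q a b c d.

Lemma tab_schoutenE k P Q :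
  tab (schouten 2 k P Q) = tab_schouten k (tab P) (tab Q).
Proof.
apply: tableP => a b c d.
have summand i : wedge (dzeta i P) (dx i Q) (bset a b c d)
      - (-1) ^+ (3 * k.+1) * wedge (dzeta i Q) (dx i P) (bset a b c d)
    = tab_summand k i (tab P) (tab Q) a b c d.
  rewrite /tab_summand -!tab_dzetaE -!tab_dxE -!tab_wedgeE signr_flip.
  by rewrite oddM.
by rewrite /tab_schouten -!summand {1}/tab /schouten fct_sumE big_I4.
Qed.

Definition tab0 f : table := fun a b c d =>
  if [|| a, b, c | d] then 0 else f.

Definition tab1 f1 f2 f3 f4 : table := fun a b c d =>
  match a, b, c, d with
  | true, false, false, false => f1
  | false, true, false, false => f2
  | false, false, true, false => f3
  | false, false, false, true => f4
  | _, _, _, _ => 0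
  end.

Definition tab2 f12 f13 f14 f23 f24 f34 : table := fun a b c d =>
  match a, b, c, d with
  | true, true, false, false => f12
  | true, false, true, false => f13
  | true, false, false, true => f14
  | false, true, true, false => f23
  | false, true, false, true => f24
  | false, false, true, true => f34
  | _, _, _, _ => 0
  end.

Definition tab3 f123 f124 f134 f234 : table := fun a b c d =>
  match a, b, c, d with
  | true, true, true, false => f123
  | true, true, false, true => f124
  | true, false, true, true => f134
  | false, true, true, true => f234
  | _, _, _, _ => 0
  end.

Definition tab4 f : table := fun a b c d =>
  if [&& a, b, c & d] then f else 0.

(** Against a factor of degree 1 only the subsets with one element removed
    contribute; this is the Laplace expansion along the last factor. *)
Lemma tab_wedge1r p f1 f2 f3 f4 a b c d :
  tab_wedge p (tab1 f1 f2 f3 f4) a b c d =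
    (if a then flip (b (+) c (+) d) (p false b c d * f1) else 0)
  + (if b then flip (c (+) d) (p a false c d * f2) else 0)
  + (if c then flip d (p a b false d * f3) else 0)
  + (if d then p a b c false * f4 else 0).
Proof.
case: a b c d => [] [] [] []; rewrite /tab_wedge /sum_le /flip /=; ring.
Qed.

End Tables.

(** * Explicit tuples of functions *)

(** All operators of the theorem are evaluated on vectors given by [col4] and
    [col6], so that calculations never look inside a matrix. *)
Section Tuples.
Variable R : realType.
Implicit Types (f : fn R) (u : 'cV[fn R]_4) (v : 'cV[fn R]_6).

Lemma col4E a b c d (w := col4 a b c d : 'cV[fn R]_4) :
  ((w i1 0 = a) * (w i2 0 = b) * (w i3 0 = c) * (w i4 0 = d))%type.
Proof. by rewrite /w /col4 !mxE !(tnth_nth 0). Qed.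

Lemma col6E a b c d e f (w := col6 a b c d e f : 'cV[fn R]_6) :
  ((w j1 0 = a) * (w j2 0 = b) * (w j3 0 = c)
   * (w j4 0 = d) * (w j5 0 = e) * (w j6 0 = f))%type.
Proof. by rewrite /w /col6 !mxE !(tnth_nth 0). Qed.

Lemma col4_eta u : u = col4 (u i1 0) (u i2 0) (u i3 0) (u i4 0).
Proof. by apply/colP; apply: all_I4; rewrite !col4E. Qed.

Lemma col6_eta v :
  v = col6 (v j1 0) (v j2 0) (v j3 0) (v j4 0) (v j5 0) (v j6 0).
Proof. by apply/colP; apply: all_I6; rewrite !col6E. Qed.

Lemma col4D (a b c d a' b' c' d' : fn R) :
  col4 a b c d + col4 a' b' c' d' = col4 (a + a') (b + b') (c + c') (d + d').
Proof. by apply/colP; apply: all_I4; rewrite [LHS]mxE !col4E. Qed.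

Lemma col4N (a b c d : fn R) :
  - col4 a b c d = col4 (- a) (- b) (- c) (- d).
Proof. by apply/colP; apply: all_I4; rewrite [LHS]mxE !col4E. Qed.

Lemma col4Z f (a b c d : fn R) :
  f *: col4 a b c d = col4 (f * a) (f * b) (f * c) (f * d).
Proof. by apply/colP; apply: all_I4; rewrite [LHS]mxE !col4E. Qed.

Lemma col6B (a b c d e f a' b' c' d' e' f' : fn R) :
  col6 a b c d e f - col6 a' b' c' d' e' f' =
  col6 (a - a') (b - b') (c - c') (d - d') (e - e') (f - f').
Proof.
by apply/colP; apply: all_I6; rewrite [LHS]mxE [X in _ + X]mxE !col6E.
Qed.

Lemma col6Z g (a b c d e f : fn R) :
  g *: col6 a b c d e f =
  col6 (g * a) (g * b) (g * c) (g * d) (g * e) (g * f).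
Proof. by apply/colP; apply: all_I6; rewrite [LHS]mxE !col6E. Qed.

Lemma opD_col4 (a b c d : fn R) : opD (col4 a b c d) = col4 d (- c) b (- a).
Proof. by rewrite /opD !col4E. Qed.

Lemma opK_col6 (a b c d e f : fn R) :
  opK (col6 a b c d e f) = col6 d f (- c) a e (- b).
Proof. by rewrite /opK !col6E. Qed.

Lemma opKinv_col6 (a b c d e f : fn R) :
  opKinv (col6 a b c d e f) = col6 d (- f) (- c) a e b.
Proof. by rewrite /opKinv !col6E. Qed.

Lemma phi_col6 (a b c d e f : fn R) :
  phi (col6 a b c d e f) = col6 (- c) d (- a) b f e.
Proof. by rewrite /phi !col6E. Qed.

Lemma cross_op_col4 (A : 'I_4 -> fn R -> fn R) (a b c d : fn R) :
  cross_op A (col4 a b c d) =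
  col6 (A i1 d - A i4 a) (A i1 b - A i2 a) (A i3 b - A i2 c)
       (A i3 d - A i4 c) (A i3 a - A i1 c) (A i2 d - A i4 b).
Proof. by rewrite /cross_op !col4E. Qed.

Lemma barcross_op_col6 (A : 'I_4 -> fn R -> fn R) (a b c d e f : fn R) :
  barcross_op A (col6 a b c d e f) =
  col4 (- A i4 c + A i2 d - A i3 f) (A i3 a - A i1 d + A i4 e)
       (- A i2 a + A i4 b + A i1 f) (- A i3 b + A i1 c - A i2 e).
Proof. by rewrite /barcross_op !col6E. Qed.

Lemma grad_col4 f :
  grad f = col4 (partial i1 f) (partial i2 f) (partial i3 f) (partial i4 f).
Proof. by rewrite [LHS]col4_eta !mxE. Qed.

Lemma delta_col4 j : delta_mx j 0 =
  col4 (i1 == j)%:R (i2 == j)%:R (i3 == j)%:R (i4 == j)%:R :> 'cV[fn R]_4.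
Proof. by rewrite [LHS]col4_eta !mxE !andbT. Qed.

Lemma dot_col4 (a b c d a' b' c' d' : fn R) :
  dot (col4 a b c d) (col4 a' b' c' d') = a * a' + b * b' + c * c' + d * d'.
Proof. by rewrite /dot big_I4 !col4E. Qed.

Lemma dot_col6 (a b c d e f a' b' c' d' e' f' : fn R) :
  dot (col6 a b c d e f) (col6 a' b' c' d' e' f') =
  a * a' + b * b' + c * c' + d * d' + e * e' + f * f'.
Proof. by rewrite /dot big_I6 !col6E. Qed.

Definition along (a b c d : fn R) f : fn R :=
  a * partial i1 f + b * partial i2 f + c * partial i3 f + d * partial i4 f.

Lemma vf_act_col6 (y1 y2 y3 y4 a b c d e f : fn R) (Y := along y1 y2 y3 y4) :
  vf_act (col4 y1 y2 y3 y4) (col6 a b c d e f) =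
  col6 (Y a) (Y b) (Y c) (Y d) (Y e) (Y f).
Proof.
have act v k : vf_act (col4 y1 y2 y3 y4) v k 0 = Y (v k 0).
  by rewrite mxE big_I4 !col4E.
by rewrite [LHS]col6_eta !act !col6E.
Qed.

Lemma grad_dot_col6 (a b c d e f a' b' c' d' e' f' : fn R)
  (G := fun i => partial i a * a' + partial i b * b' + partial i c * c'
                 + partial i d * d' + partial i e * e' + partial i f * f') :
  grad_dot (col6 a b c d e f) (col6 a' b' c' d' e' f') =
  col4 (G i1) (G i2) (G i3) (G i4).
Proof.
have entry i : grad_dot (col6 a b c d e f) (col6 a' b' c' d' e' f') i 0 = G i.
  by rewrite mxE big_I6 !col6E.
by rewrite [LHS]col4_eta !entry.
Qed.

Lemma cross_col4 (x1 x2 x3 x4 y1 y2 y3 y4 : fn R) :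
  cross (col4 x1 x2 x3 x4) (col4 y1 y2 y3 y4) =
  col6 (x1 * y4 - x4 * y1) (x1 * y2 - x2 * y1) (x3 * y2 - x2 * y3)
       (x3 * y4 - x4 * y3) (x3 * y1 - x1 * y3) (x2 * y4 - x4 * y2).
Proof. by rewrite /cross cross_op_col4 !col4E. Qed.

Lemma barcross_col4 (x1 x2 x3 x4 a b c d e f : fn R) :
  barcross (col4 x1 x2 x3 x4) (col6 a b c d e f) =
  col4 (- (x4 * c) + x2 * d - x3 * f) (x3 * a - x1 * d + x4 * e)
       (- (x2 * a) + x4 * b + x1 * f) (- (x3 * b) + x1 * c - x2 * e).
Proof. by rewrite /barcross barcross_op_col6 !col4E. Qed.

Lemma of_coefsE n (B : n.-tuple {set 'I_4}) (w : 'cV[fn R]_n) S :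
  of_coefs B w S = \sum_(k < n) if S == tnth B k then w k 0 else 0.
Proof. by rewrite /of_coefs fct_sumE. Qed.

Lemma tab_vec0 f : tab (vec0 f) = tab0 f.
Proof.
apply: tableP => a b c d; rewrite /tab /vec0 /mono bset0 eq_bset.
by case: a b c d => [] [] [] [].
Qed.

Lemma tab_vec1 (a b c d : fn R) : tab (vec1 (col4 a b c d)) = tab1 a b c d.
Proof.
apply: tableP => x y z t; rewrite /tab /vec1 of_coefsE big_I4 !col4E.
rewrite !(tnth_nth finset.set0) /= !bset1 !eq_bset.
by case: x y z t => [] [] [] [] /=; rewrite ?add0r ?addr0.
Qed.

Lemma tab_vec2 (a b c d e f : fn R) :
  tab (vec2 (col6 a b c d e f)) = tab2 a b c d e f.
Proof.
apply: tableP => x y z t; rewrite /tab /vec2 of_coefsE big_I6 !col6E.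
rewrite !(tnth_nth finset.set0) /= !bset1 !bsetU !eq_bset.
by case: x y z t => [] [] [] [] /=; rewrite ?add0r ?addr0.
Qed.

Lemma tab_vec3 (a b c d : fn R) : tab (vec3 (col4 a b c d)) = tab3 a b c d.
Proof.
apply: tableP => x y z t; rewrite /tab /vec3 of_coefsE big_I4 !col4E.
rewrite !(tnth_nth finset.set0) /= !bset1 !bsetU !eq_bset.
by case: x y z t => [] [] [] [] /=; rewrite ?add0r ?addr0.
Qed.

Lemma tab_vec4 f : tab (vec4 f) = tab4 f.
Proof.
apply: tableP => a b c d; rewrite /tab /vec4 /mono bsetT eq_bset.
by case: a b c d => [] [] [] [].
Qed.

Lemma homogeneous_tab n (P : ext R) (a b c d : bool) :
  homogeneous n P -> (a + b + c + d)%N != n -> tab P a b c d = 0.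
Proof. by move=> hP ne; apply: hP; rewrite card_bset. Qed.

Lemma homogeneous1 (P : ext R) : homogeneous 1 P -> P = vec1 (coefs supp1 P).
Proof.
move=> hP; apply: tab_inj; rewrite [coefs _ _]col4_eta tab_vec1 !mxE.
rewrite !(tnth_nth finset.set0) /= !bset1; apply: tableP.
by do 4!case => //; exact: homogeneous_tab hP _.
Qed.

Lemma homogeneous2 (P : ext R) : homogeneous 2 P -> P = vec2 (coefs supp2 P).
Proof.
move=> hP; apply: tab_inj; rewrite [coefs _ _]col6_eta tab_vec2 !mxE.
rewrite !(tnth_nth finset.set0) /= !bset1 !bsetU; apply: tableP.
by do 4!case => //; exact: homogeneous_tab hP _.
Qed.

Lemma homogeneous3 (P : ext R) : homogeneous 3 P -> P = vec3 (coefs supp3 P).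
Proof.
move=> hP; apply: tab_inj; rewrite [coefs _ _]col4_eta tab_vec3 !mxE.
rewrite !(tnth_nth finset.set0) /= !bset1 !bsetU; apply: tableP.
by do 4!case => //; exact: homogeneous_tab hP _.
Qed.

End Tuples.

(** * The Jacobian bivector field *)

Section Jacobian.
Variable R : realType.
Implicit Types (mu P Q f : fn R).

Lemma dform_tab f :
  tab (dform f) =
  tab1 (partial i1 f) (partial i2 f) (partial i3 f) (partial i4 f).
Proof.
rewrite -tab_vec1 -grad_col4 /dform /vec1 /of_coefs !big_I4.
by rewrite !(tnth_nth finset.set0) /= !mxE.
Qed.

Lemma mono1_tab (i : 'I_4) f : tab (mono [set i] f) =
  tab1 (if i == i1 then f else 0) (if i == i2 then f else 0)
       (if i == i3 then f else 0) (if i == i4 then f else 0).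
Proof.
apply: tableP => a b c d; rewrite /tab /mono bset1 eq_bset.
by move: i; apply: all_I4; case: a b c d => [] [] [] [].
Qed.

(** Expanding the determinant [dx_i /\ dx_j /\ dP /\ dQ] twice along its last
    factors leaves the 2 by 2 minors of [(grad P, grad Q)]; the column
    [delta_mx j 0] is the gradient of [x_j]. *)
Lemma jbracketE mu P Q i j : jbracket mu P Q i j =
  mu * barcross (delta_mx j 0) (cross (grad P) (grad Q)) i 0.
Proof.
rewrite /jbracket bsetT -[wedge _ _ _]/(tab _ true true true true).
rewrite !tab_wedgeE !mono1_tab !dform_tab !tab_wedge1r /flip /=.
rewrite !grad_col4 cross_col4 delta_col4 barcross_col4; congr (_ * _).
(* An opaque [D] keeps [ring] from comparing partial derivatives by unfolding
   them into limits; the same is done in the calculations below. *)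
move: (@partial R) => D.
move: i j; apply: all_I4; apply: all_I4; rewrite !col4E /=; ring.
Qed.

Lemma barcross_sum (x : 'cV[fn R]_4) (U : 'cV[fn R]_6) i :
  barcross x U i 0 = \sum_j barcross (delta_mx j 0) U i 0 * x j 0.
Proof.
rewrite [U]col6_eta [in LHS](col4_eta x) big_I4 !delta_col4 !barcross_col4.
by move: i; apply: all_I4; rewrite !col4E /=; ring.
Qed.

Lemma hamE mu P Q i f :
  ham mu P Q i f = mu * barcross (grad f) (cross (grad P) (grad Q)) i 0.
Proof.
rewrite /ham barcross_sum mulr_sumr; apply: eq_bigr => j _.
by rewrite jbracketE -mulrA [grad f j 0]mxE.
Qed.

Lemma jpiE mu P Q :
  jpi mu P Q = vec2 (opKinv (mu *: cross (grad P) (grad Q))).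
Proof.
apply: tab_inj; rewrite [cross _ _]col6_eta col6Z opKinv_col6 tab_vec2.
apply: tableP => a b c d; rewrite /tab /jpi fct_sumE.
under eq_bigr => i _ do rewrite fct_sumE big_mkcond.
rewrite !big_I4 !jbracketE /mono !bset1 !bsetU !eq_bset.
move: (cross _ _) => U; rewrite [U in barcross _ U]col6_eta.
rewrite !delta_col4 !barcross_col4 !col4E.
case: a b c d => [] [] [] []; rewrite /tab2 /=; ring.
Qed.

Lemma cross_partials P Q :
    (forall i, has_partials (partial i P)) ->
    (forall i, has_partials (partial i Q)) ->
  forall k, has_partials (cross (grad P) (grad Q) k 0).
Proof.
move=> dP dQ; rewrite !grad_col4 cross_col4.
have minor a b c d :
    has_partials (partial a P * partial b Q - partial c P * partial d Q).
  exact: has_partialsD (has_partialsM (dP a) (dQ b))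
                       (has_partialsN (has_partialsM (dP c) (dQ d))).
by apply: all_I6; rewrite !col6E; exact: minor.
Qed.

(** The four entries are, up to sign, the coefficients of [d (dP /\ dQ)], which
    vanish because second derivatives commute. *)
Lemma cross_grad_closed P Q :
    (forall i, has_partials (partial i P)) ->
    (forall i, has_partials (partial i Q)) ->
    (forall i j, partial i (partial j P) = partial j (partial i P)) ->
    (forall i j, partial i (partial j Q) = partial j (partial i Q)) ->
  barcross_op (@partial R) (cross (grad P) (grad Q)) = 0.
Proof.
move=> dP dQ cP cQ.
have minor i a b c d :
    partial i (partial a P * partial b Q - partial c P * partial d Q) =
    partial i (partial a P) * partial b Q + partial a P * partial i (partial b Q)
    - (partial i (partial c P) * partial d Q
       + partial c P * partial i (partial d Q)).
  have dPQ k l : has_partials (partial k P * partial l Q) by exact: has_partialsM.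
  rewrite (partialD _ (dPQ _ _) (has_partialsN (dPQ _ _))) (partialN _ (dPQ _ _)).
  by rewrite !(partialM _ (dP _) (dQ _)).
rewrite !grad_col4 cross_col4 barcross_op_col6.
move: (@partial R) cP cQ minor {dP dQ} => D cP cQ minor; rewrite !minor.
rewrite (cP i2 i1) (cP i3 i1) (cP i4 i1) (cP i3 i2) (cP i4 i2) (cP i4 i3).
rewrite (cQ i2 i1) (cQ i3 i1) (cQ i4 i1) (cQ i3 i2) (cQ i4 i2) (cQ i4 i3).
by apply/colP; apply: all_I4; rewrite !col4E [RHS]mxE; ring.
Qed.

End Jacobian.

(** * The Schouten bracket with the bivector field of mu U *)

(** [U] stands for [cross (grad P1) (grad P2)] but is only assumed closed; [X i]
    are the Hamiltonian vector fields of the coordinates. *)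
Section Coboundary.
Variables (R : realType) (mu : fn R) (u : 'I_6 -> fn R).
Hypothesis mu_partials : has_partials mu.
Hypothesis u_partials : forall k, has_partials (u k).
Let U := col6 (u j1) (u j2) (u j3) (u j4) (u j5) (u j6).
Hypothesis U_closed : barcross_op (@partial R) U = 0.
Implicit Types f : fn R.
Variable X : 'I_4 -> fn R -> fn R.
Hypothesis X_ham : forall i f, X i f = mu * barcross (grad f) U i 0.
Let dmu := barcross (grad mu) U.
Let bivec := vec2 (opKinv (mu *: U)).

Let partial_mul i k :
  partial i (mu * u k) = partial i mu * u k + mu * partial i (u k).
Proof. exact: (partialM i mu_partials (@u_partials k)). Qed.

Let partial_Nmul i k : partial i (- (mu * u k)) = - partial i (mu * u k).
Proof.
exact: (partialN i (has_partialsM mu_partials (@u_partials k))).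
Qed.

(** The four closedness equations, each solved for a derivative that the others
    do not mention, so that they can be used as rewrite rules before [ring]. *)
Let closedE :
  [/\ partial i2 (u j4) = partial i4 (u j3) + partial i3 (u j6),
      partial i1 (u j4) = partial i3 (u j1) + partial i4 (u j5),
      partial i1 (u j6) = partial i2 (u j1) - partial i4 (u j2)
    & partial i1 (u j3) = partial i3 (u j2) + partial i2 (u j5)].
Proof.
have e i : barcross_op (@partial R) U i 0 = 0 by rewrite U_closed mxE.
move: (e i1) (e i2) (e i3) (e i4); rewrite /U barcross_op_col6 !col4E.
move: (@partial R) => D e1 e2 e3 e4.
split; apply/eqP; rewrite -subr_eq0; apply/eqP.
- by rewrite -[RHS]e1; ring.
- by rewrite -[RHS]oppr0 -[in RHS]e2; ring.
- by rewrite -[RHS]e3; ring.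
- by rewrite -[RHS]e4; ring.
Qed.

Let X_coords (D := @partial R) :
  [/\ forall f, X i1 f =
        mu * (- (D i4 f * u j3) + D i2 f * u j4 - D i3 f * u j6),
      forall f, X i2 f =
        mu * (D i3 f * u j1 - D i1 f * u j4 + D i4 f * u j5),
      forall f, X i3 f =
        mu * (- (D i2 f * u j1) + D i4 f * u j2 + D i1 f * u j6)
    & forall f, X i4 f =
        mu * (- (D i3 f * u j2) + D i1 f * u j3 - D i2 f * u j5)].
Proof. by split=> f; rewrite X_ham /U grad_col4 barcross_col4 !col4E. Qed.

Lemma schouten0_jacobian f :
  schouten 2 0 bivec (vec0 f) = vec1 (mu *: barcross (grad f) U).
Proof.
rewrite /bivec /U grad_col4 barcross_col4 col4Z col6Z opKinv_col6.
apply: tab_inj; rewrite tab_schoutenE tab_vec0 tab_vec1 tab_vec2.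
rewrite /tab_schouten /tab_summand /tab_wedge /tab_dzeta /sum_le /tab_dx.
move: (@partial0 R); move: (@partial R) => D D0.
rewrite /tab0 /tab1 /tab2 /flip.
apply: tableP; do 4!case; rewrite /= ?D0; ring.
Qed.

Lemma schouten1_jacobian (y : 'I_4 -> fn R)
    (Y := col4 (y i1) (y i2) (y i3) (y i4)) :
  schouten 2 1 bivec (vec1 Y) =
  vec2 (opKinv (phi (cross_op X Y) - vf_act Y (mu *: U))).
Proof.
rewrite /bivec /Y /U cross_op_col4 col6Z vf_act_col6 phi_col6 col6B.
rewrite !opKinv_col6.
apply: tab_inj; rewrite tab_schoutenE tab_vec1 !tab_vec2 /along.
have [X1 X2 X3 X4] := X_coords; rewrite !X1 !X2 !X3 !X4.
rewrite /tab_schouten /tab_summand /tab_wedge /tab_dzeta /sum_le /tab_dx.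
move: (@partial0 R) partial_Nmul; move: (@partial R) => D D0 DN.
rewrite /tab1 /tab2 /flip.
apply: tableP; do 4!case; rewrite /= ?D0 ?DN; ring.
Qed.

(** The bracket contains the cyclic sums over [i, j, k] of
    [sum_l W_il * partial_l (pi_jk)], whereas [grad_dot] differentiates all entries
    of [mu U] in the same direction.  As [U] is closed, the two differ by
    derivatives of [mu] only, which form the term in [dmu]. *)
Lemma schouten2_jacobian (w : 'I_6 -> fn R)
    (w_partials : forall k, has_partials (w k))
    (W := col6 (w j1) (w j2) (w j3) (w j4) (w j5) (w j6)) (V := phi (opK W)) :
  schouten 2 2 bivec (vec2 W) =
  vec3 (opD (- barcross_op X V + barcross dmu V + grad_dot (mu *: U) V)).
Proof.
have DNw i k : partial i (- w k) = - partial i (w k).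
  exact: (partialN i (@w_partials k)).
rewrite /bivec /V /W /dmu /U opK_col6 phi_col6 col6Z opKinv_col6.
rewrite barcross_op_col6 grad_dot_col6 !grad_col4 !barcross_col4.
rewrite col4N !col4D opD_col4 !opprK.
have [X1 X2 X3 X4] := X_coords; rewrite !X1 !X2 !X3 !X4.
apply: tab_inj; rewrite tab_schoutenE !tab_vec2 tab_vec3.
rewrite /tab_schouten /tab_summand /tab_wedge /tab_dzeta /sum_le /tab_dx.
move: (@partial0 R) partial_mul partial_Nmul closedE DNw.
move: (@partial R) => D D0 DM DN [cl1 cl2 cl3 cl4] DNw.
rewrite /tab2 /tab3 /flip.
apply: tableP; do 4!case; rewrite /= ?D0 ?DN ?DM ?DNw ?cl1 ?cl2 ?cl3 ?cl4; ring.
Qed.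

(** Where the bracket does not differentiate [Z], each coefficient of [Z] is
    multiplied by a divergence [sum_l partial_l (pi_lm)], up to sign.  For
    [pi = K^-1 (mu U)] with [U] closed, this is an entry of [dmu]. *)
Lemma schouten3_jacobian (z : 'I_4 -> fn R)
    (z_partials : forall k, has_partials (z k))
    (Z := col4 (z i1) (z i2) (z i3) (z i4)) (V := opD Z) :
  schouten 2 3 bivec (vec3 Z) = vec4 (- mu * dot (curl V) (phi U) - dot V dmu).
Proof.
have DNz i k : partial i (- z k) = - partial i (z k).
  exact: (partialN i (@z_partials k)).
rewrite /bivec /V /Z /dmu /U opD_col4 /curl cross_op_col4 phi_col6.
rewrite grad_col4 barcross_col4 dot_col4 dot_col6 col6Z opKinv_col6.
apply: tab_inj; rewrite tab_schoutenE !tab_vec2 tab_vec3 tab_vec4.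
rewrite /tab_schouten /tab_summand /tab_wedge /tab_dzeta /sum_le /tab_dx.
move: (@partial0 R) partial_mul partial_Nmul closedE DNz.
move: (@partial R) => D D0 DM DN [cl1 cl2 cl3 cl4] DNz.
rewrite /tab2 /tab3 /tab4 /flip.
apply: tableP; do 4!case; rewrite /= ?D0 ?DN ?DM ?DNz ?cl1 ?cl2 ?cl3 ?cl4; ring.
Qed.

End Coboundary.

(** * The coboundary operators *)

Theorem proposition4p1 (R : realType) (mu : fn R) (mu_smooth : smooth mu)
    (p1 p2 : mpoly.mpoly 4 R) :
  let P1 := poly_fn p1 in
  let P2 := poly_fn p2 in
  let d := cobd mu P1 P2 in
  let X := ham mu P1 P2 in
  let U := cross (grad P1) (grad P2) in
  [/\ forall g : fn R, smooth g ->
        d 0%N (vec0 g) = vec1 (mu *: barcross (grad g) U),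
      forall Y : ext R, mvfield 1 Y ->
        let y := coefs supp1 Y in
        d 1%N Y = vec2 (opKinv (phi (cross_op X y) - vf_act y (mu *: U))),
      forall W : ext R, mvfield 2 W ->
        let w := phi (opK (coefs supp2 W)) in
        d 2%N W = vec3 (opD (- barcross_op X w + barcross (dlog mu P1 P2) w
                             + grad_dot (mu *: U) w))
    & forall Z : ext R, mvfield 3 Z ->
        let z := opD (coefs supp3 Z) in
        d 3%N Z = vec4 (- mu * dot (curl z) (phi U)
                        - dot z (dlog mu P1 P2))].
Proof.
move=> P1 P2 d X U.
pose u k := U k 0; pose muP := smooth_partials mu_smooth.
have dP1 i : has_partials (partial i P1) by exact: has_partials_grad_poly.
have dP2 i : has_partials (partial i P2) by exact: has_partials_grad_poly.
have uP k : has_partials (u k) by exact: cross_partials dP1 dP2 k.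
have eU : U = col6 (u j1) (u j2) (u j3) (u j4) (u j5) (u j6) by exact: col6_eta.
have closedU : barcross_op (@partial R) U = 0.
  exact: (cross_grad_closed dP1 dP2 (fun i j => partial_poly_comm i j p1)
                            (fun i j => partial_poly_comm i j p2)).
have hamX i f : X i f = mu * barcross (grad f) U i 0 by exact: hamE.
rewrite /d /cobd jpiE /dlog -/U.
move: U u uP eU closedU hamX => U u uP -> closedU hamX.
split=> [g _|Y [Y1 _]|W [W2 W_smooth]|Z [Z3 Z_smooth]].
- exact: schouten0_jacobian.
- move: (coefs supp1 Y) (homogeneous1 Y1) => y ->; rewrite (col4_eta y).
  exact: (schouten1_jacobian muP uP hamX (fun k => y k 0)).
- have wP k : has_partials (coefs supp2 W k 0).
    by rewrite mxE; exact: smooth_partials.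
  move: (coefs supp2 W) (homogeneous2 W2) wP => w -> wP; rewrite (col6_eta w).
  exact: (schouten2_jacobian muP uP closedU hamX wP).
- have zP k : has_partials (coefs supp3 Z k 0).
    by rewrite mxE; exact: smooth_partials.
  move: (coefs supp3 Z) (homogeneous3 Z3) zP => z -> zP; rewrite (col4_eta z).
  exact: (schouten3_jacobian muP uP closedU zP).
Qed.
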